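(* Let $n_1,n_2$ be integers with $-2>n_1>n_2$, and put $l_i:=-2-n_i$, $d:=l_2-l_1=n_1-n_2$. Let $$\mathfrak{Q}_0:=\Big(\mathbb{C}[X_0,X_1]^*_{l_1}\oplus\big(\mathbb{C}[X_0,X_1]^*_{l_2}\setminus\{0\}\big)\Big)\big/G_0,$$ endowed with the quotient topology, and let $H$ be the morphism of linear spaces over $\mathcal{P}=\mathbb{P}(\mathbb{C}[X_0,X_1]^*_{l_2})$ $$H:\Theta_{\mathcal{P}}\otimes_{\mathbb{C}}\mathbb{C}[X_0,X_1]_d\to\mathcal{P}\times\mathbb{C}[X_0,X_1]^*_{l_1},\qquad H_{[\Phi]}(\Phi\otimes Q)=\big([\Phi],{}^{\mathrm t}m_Q(\Phi)\big).$$ Then there is a natural homeomorphism $\mathfrak{Q}_0\xrightarrow{\ \simeq\ }\mathrm{Coker}(H)$, where $\mathrm{Coker}(H)$ is the topological cokernel of $H$.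
   Context: $\mathbb{C}[X_0,X_1]_k$ is the space of homogeneous polynomials of degree $k$; $^*$ is the dual. For $Q\in\mathbb{C}[X_0,X_1]_d$, $m_Q:\mathbb{C}[X_0,X_1]_{l_1}\to\mathbb{C}[X_0,X_1]_{l_2}$ is multiplication by $Q$ and ${}^{\mathrm t}m_Q:\mathbb{C}[X_0,X_1]_{l_2}^*\to\mathbb{C}[X_0,X_1]_{l_1}^*$ its transpose. The group $$G_0=\left\{\begin{pmatrix}1&Q\\ 0&u_2\end{pmatrix}\ \middle|\ u_2\in\mathbb{C}^*,\ Q\in\mathbb{C}[X_0,X_1]_d\right\}$$ acts on $\mathbb{C}[X_0,X_1]^*_{l_1}\oplus\mathbb{C}[X_0,X_1]^*_{l_2}$ by $\begin{pmatrix}1&Q\\ 0&u_2\end{pmatrix}\begin{pmatrix}\Phi_1\\ \Phi_2\end{pmatrix}=\begin{pmatrix}\Phi_1+{}^{\mathrm t}m_Q(\Phi_2)\\ u_2\Phi_2\end{pmatrix}$. (The space $\mathfrak{Q}_0$ is the moduli space of framed non-degenerate rank 2 affine bundles on $\mathbb{P}^1_{\mathbb{C}}$ with linearisation isomorphic to $\mathcal{O}(n_1)\oplus\mathcal{O}(n_2)$.) $\mathcal{P}=(\mathbb{C}[X_0,X_1]^*_{l_2}\setminus\{0\})/\mathbb{C}^*$ is the projective space of lines and $\Theta_{\mathcal{P}}$ is its tautological line bundle, whose fibre over $[\Phi]$ is $\mathbb{C}\Phi$. Topological cokernel: for a morphism $\varphi:L\to L'$ of linear spaces over a complex manifold $X$,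 with projections $p:L\to X$ and $p':L'\to X$, $\mathrm{Coker}(\varphi)$ is the topological quotient of $L'$ by the equivalence relation: $y'\sim z'$ iff $p'(y')=p'(z')$ and there exists $y\in L$ (in the fibre over this point) with $z'-y'=\varphi(y)$. Set-theoretically both sides are identified in the obvious way with $\coprod_{[\Phi]\in\mathcal{P}}\mathrm{coker}\big(\mathbb{C}[X_0,X_1]_d\ni Q\mapsto{}^{\mathrm t}m_Q(\Phi)\in\mathbb{C}[X_0,X_1]^*_{l_1}\big)$, the class of $(\Phi_1,\Phi_2)$ corresponding to the class of $\Phi_1$ in the cokernel indexed by $[\Phi_2]$. *)

(* Defs.v *)
From HB Require Import structures.
From mathcomp Require Import all_boot all_order all_algebra.
From mathcomp Require Import generic_quotient.
From mathcomp Require Import all_classical all_reals.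
From mathcomp Require Import topology normedtype.
From mathcomp Require Import complex.
From mathcomp Require mpoly.
(* Neither the notations nor the names of mpoly (symmetric, in particular) are
   imported: they clash with those of the other libraries. *)
Export (canonicals, coercions) mpoly.

Set Implicit Arguments.
Unset Strict Implicit.
Unset Printing Implicit Defensive.

Import Order.TTheory GRing.Theory Num.Theory.
Import numFieldNormedType.Exports.

Local Open Scope classical_set_scope.
Local Open Scope ring_scope.
Local Open Scope quotient_scope.

Definition homeomorphism (X Y : topologicalType) (f : X -> Y) : Prop :=
  continuous f /\
  exists g : Y -> X, [/\ continuous g, cancel f g & cancel g f].

Definition coords (K : fieldType) (V : vectType K) (v : V) :
    'rV[K]_(\dim {:V}) :=
  \row_i coord (vbasis {:V}) i v.

(* The usual topology of a finite-dimensional K-vector space: the one for which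
   the coordinate isomorphism with K^n is a homeomorphism. *)
Definition fdtop (K : numFieldType) (V : vectType K) : Type := V.

HB.instance Definition _ (K : numFieldType) (V : vectType K) :=
  Vector.copy (fdtop V) V.
HB.instance Definition _ (K : numFieldType) (V : vectType K) :=
  Topological.copy (fdtop V) (initial_topology (@coords K V)).

Lemma fdtop_coord_continuous (K : numFieldType) (V : vectType K)
    (i : 'I_(\dim {:V})) :
  continuous (fun v : fdtop V => coord (vbasis {:V}) i v : K).
Proof.
have -> : (fun v : fdtop V => coord (vbasis {:V}) i v : K) =
          (fun M : 'rV[K]_(\dim {:V}) => M 0 i) \o (@coords K V).
  by apply/funext => v /=; rewrite mxE.
move=> v; apply: continuous_comp; last exact: coord_continuous.
exact: initial_continuous.
Qed.

Lemma fdtop_linear_continuous (K : numFieldType) (V W : vectType K)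
    (f : {linear V -> W}) :
  continuous (f : fdtop V -> fdtop W).
Proof.
apply: continuous_comp_initial.
have -> : (@coords K W) \o f =
    (fun u => \sum_i coord (vbasis {:V}) i u *: coords (f (vbasis {:V})`_i)).
  apply/funext => u /=; apply/rowP => j.
  rewrite {1}(coord_vbasis (memvf u)) linear_sum summxE mxE linear_sum.
  by apply: eq_bigr => i _; rewrite !linearZ !mxE.
apply: continuous_big => [|i _]; first exact: add_continuous.
have scZ (T : topologicalType) (g : T -> K) (a : 'rV[K]_(\dim {:W})) :
    continuous g -> continuous (fun x => g x *: a).
  by move=> cg x; apply: cvgZr_tmp; exact: cg.
by apply: (scZ (fdtop V)); exact: fdtop_coord_continuous.
Qed.

Definition dual (K : numFieldType) (V : vectType K) : Type :=
  fdtop 'Hom(V, K^o).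

HB.instance Definition _ (K : numFieldType) (V : vectType K) :=
  Vector.on (dual V).
HB.instance Definition _ (K : numFieldType) (V : vectType K) :=
  Topological.on (dual V).

Definition transpose (K : numFieldType) (V W : vectType K) (f : 'Hom(V, W))
  (Phi : dual W) : dual V := (Phi \o f)%VF.

Section Tensor.
Variable K : fieldType.
Implicit Types U V W : vectType K.

(* W (x) V in coordinates: the matrix M stands for
   \sum_(i, j) M i j e_i (x) f_j, where (e_i) and (f_j) are the chosen bases of
   W and V. *)
Definition tensor W V : Type := 'M[K]_(\dim {:W}, \dim {:V}).

HB.instance Definition _ W V := Vector.on (tensor W V).

Definition tens W V (w : W) (v : V) : tensor W V :=
  \matrix_(i, j) (coord (vbasis {:W}) i w * coord (vbasis {:V}) j v).

Definition tens_vs W V (A : {vspace W}) (B : {vspace V}) :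
    {vspace tensor W V} :=
  <<[seq tens a b | a <- vbasis A, b <- vbasis B]>>%VS.

Lemma tens_linear W V (w : W) : linear (@tens W V w).
Proof.
move=> a u v; apply/matrixP => i j; rewrite !mxE linearP mulrDr.
by congr (_ + _); rewrite mulrCA.
Qed.

HB.instance Definition _ W V (w : W) :=
  GRing.isLinear.Build K V (tensor W V) _ (@tens W V w) (@tens_linear W V w).

Lemma tens_linearl W V (v : V) : linear ((@tens W V)^~ v).
Proof.
by move=> a u w; apply/matrixP => i j; rewrite !mxE linearP mulrDl -mulrA.
Qed.

Lemma tensZl W V a (w : W) (v : V) : tens (a *: w) v = a *: tens w v.
Proof. by apply/matrixP => i j; rewrite !mxE linearZ -mulrA. Qed.

Lemma tensZr W V a (w : W) (v : V) : tens w (a *: v) = a *: tens w v.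
Proof. by apply/matrixP => i j; rewrite !mxE linearZ mulrCA. Qed.

Lemma mem_tens_vs W V (A : {vspace W}) (B : {vspace V}) a b :
  a \in A -> b \in B -> tens a b \in tens_vs A B.
Proof.
move=> aA bB; have -> : tens a b = \sum_i \sum_j
    (coord (vbasis A) i a * coord (vbasis B) j b) *:
    tens (vbasis A)`_i (vbasis B)`_j.
  apply/matrixP => k l; rewrite mxE {1}(coord_vbasis aA) {1}(coord_vbasis bB).
  rewrite !linear_sum big_distrlr summxE; apply: eq_bigr => i _ /=.
  by rewrite summxE; apply: eq_bigr => j _; rewrite !mxE !linearZ /= mulrACA.
apply: memv_suml => i _; apply: memv_suml => j _; apply: memvZ.
by apply: memv_span; apply: allpairs_f; apply: mem_nth; rewrite size_tuple.
Qed.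

(* The linear map on the tensor product induced by a bilinear map. *)
Definition tens_lift W V U (b : W -> V -> U) (M : tensor W V) : U :=
  \sum_i \sum_j M i j *: b (vbasis {:W})`_i (vbasis {:V})`_j.

Lemma tens_lift_is_linear W V U (b : W -> V -> U) : linear (tens_lift b).
Proof.
move=> a M N; rewrite /tens_lift scaler_sumr -big_split /=.
apply: eq_bigr => i _; rewrite scaler_sumr -big_split /=.
by apply: eq_bigr => j _; rewrite !mxE scalerDl scalerA.
Qed.

HB.instance Definition _ W V U (b : W -> V -> U) :=
  GRing.isLinear.Build K (tensor W V) U _ (tens_lift b)
    (tens_lift_is_linear b).

Lemma tens_liftE W V U (b : W -> V -> U) :
    (forall w, linear (b w)) -> (forall v, linear (b^~ v)) ->
  forall w v, tens_lift b (tens w v) = b w v.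
Proof.
move=> bl br w v.
pose bw w := HB.pack (b w) (GRing.isLinear.Build K V U _ (b w) (bl w)) :
  {linear V -> U}.
pose bv v := HB.pack (b^~ v) (GRing.isLinear.Build K W U _ (b^~ v) (br v)) :
  {linear W -> U}.
have bvE : bv v w = \sum_i coord (vbasis {:W}) i w *: b (vbasis {:W})`_i v.
  rewrite {1}(coord_vbasis (memvf w)) linear_sum.
  by apply: eq_bigr => i _; rewrite linearZ.
have bwE i : bw (vbasis {:W})`_i v = \sum_j coord (vbasis {:V}) j v *:
    b (vbasis {:W})`_i (vbasis {:V})`_j.
  rewrite {1}(coord_vbasis (memvf v)) linear_sum.
  by apply: eq_bigr => j _; rewrite linearZ.
rewrite -[RHS]/(bv v w) bvE; apply: eq_bigr => i _.
rewrite -[b _ v]/(bw _ v) bwE scaler_sumr.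
by apply: eq_bigr => j _; rewrite mxE -scalerA.
Qed.

End Tensor.

Section ProjectiveSpace.
Variables (K : numFieldType) (W : vectType K).

Definition nonzero : Type := set_type [set w : fdtop W | w != 0].

HB.instance Definition _ := Topological.on nonzero.

Definition nzval (w : nonzero) : fdtop W := set_val w.

Lemma nzvalP (w : nonzero) : nzval w != 0.
Proof. by case: w => w h; exact: (set_mem h). Qed.

Definition collinear (v w : nonzero) : bool :=
  `[< exists c : K, c != 0 /\ nzval w = c *: nzval v >].

Lemma collinear_refl : reflexive collinear.
Proof. by move=> v; apply/asboolP; exists 1; rewrite oner_neq0 scale1r. Qed.

Lemma collinear_sym : symmetric collinear.
Proof.
suff h v w : collinear v w -> collinear w v by move=> v w; apply/idP/idP; exact: h.
move=> /asboolP[c [c0 e]]; apply/asboolP; exists c^-1.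
by rewrite invr_neq0 // e scalerA mulVf // scale1r.
Qed.

Lemma collinear_trans : transitive collinear.
Proof.
move=> v u w /asboolP[c [c0 e]] /asboolP[c' [c'0 e']]; apply/asboolP.
by exists (c' * c); rewrite mulf_neq0 // e' e scalerA.
Qed.

Definition collinear_equiv :=
  EquivRel collinear collinear_refl collinear_sym collinear_trans.

(* The projective space of lines of W. *)
Definition projspace : Type := quotient_topology {eq_quot collinear_equiv}.

HB.instance Definition _ := Topological.on projspace.
HB.instance Definition _ := Quotient.on projspace.

Definition pline (w : nonzero) : projspace := \pi_projspace w.

Lemma plineP (v w : nonzero) : pline v = pline w <-> collinear v w.
Proof. by split => [/eqmodP|h] //; exact/eqmodP. Qed.

(* The fibre over [w] of the tautological line bundle. *)
Definition taut (x : projspace) : {vspace W} := <[nzval (repr x) : W]>%VS.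

Lemma taut_pline (w : nonzero) : taut (pline w) = <[nzval w : W]>%VS.
Proof.
have /plineP/asboolP[c [c0 e]] : pline (repr (pline w)) = pline w by exact: reprK.
rewrite /taut e; apply/eqP; rewrite eqEsubv -!memvE.
apply/andP; split; last by rewrite memvZ ?memv_line.
by rewrite -[X in X \in _](scalerK c0) memvZ ?memv_line.
Qed.


End ProjectiveSpace.

(* A family of vector spaces over X: the topological space and the fibrewise
   vector space structure underlying a linear space over X. *)
Record vfamily (K : numFieldType) (X : topologicalType) := VFamily {
  vtotal :> topologicalType;
  vproj : vtotal -> X;
  vfibre : X -> lmodType K;
  vincl : forall x, vfibre x -> vtotal;
  vproj_continuous : continuous vproj;
  vincl_inj : forall x, injective (@vincl x);
  vproj_incl : forall x (v : vfibre x), vproj (vincl v) = x;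
  vincl_surj : forall y, exists v : vfibre (vproj y), vincl v = y }.

Record vmorphism (K : numFieldType) (X : topologicalType)
    (L L' : vfamily K X) := VMorphism {
  vfun :> L -> L';
  vfibfun : forall x, {linear vfibre L x -> vfibre L' x};
  vfun_continuous : continuous vfun;
  vfun_incl : forall x (v : vfibre L x), vfun (vincl v) = vincl (vfibfun x v) }.

Section Cokernel.
Variables (K : numFieldType) (X : topologicalType) (L L' : vfamily K X).
Variable phi : vmorphism L L'.

Definition coker_rel (y z : L') : bool :=
  `[< exists x (u v : vfibre L' x) (w : vfibre L x),
      [/\ vincl u = y, vincl v = z & vincl (v - u) = phi (vincl w)] >].

Lemma coker_refl : reflexive coker_rel.
Proof.
move=> y; have [v e] := vincl_surj y; apply/asboolP; exists (vproj y), v, v, 0.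
by split => //; rewrite vfun_incl linear0 subrr.
Qed.

Lemma coker_sym : symmetric coker_rel.
Proof.
suff h y z : coker_rel y z -> coker_rel z y by move=> y z; apply/idP/idP; exact: h.
move=> /asboolP[x [u [v [w [eu ev]]]]]; rewrite vfun_incl => /vincl_inj e.
apply/asboolP; exists x, v, u, (- w).
by split => //; rewrite vfun_incl linearN -e opprB.
Qed.

Lemma coker_trans : transitive coker_rel.
Proof.
move=> y t z /asboolP[x [u [v [w [eu ev]]]]]; rewrite vfun_incl => /vincl_inj e.
move=> /asboolP[x' [v' [s [w' [ev' es]]]]]; rewrite vfun_incl => /vincl_inj e'.
have xx' : x = x' by rewrite -(vproj_incl v) -(vproj_incl v') ev ev'.
move: v' s w' ev' es e'; rewrite -xx' => v' s w' ev' es e'.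
have vv' : v' = v by apply: (@vincl_inj _ _ L'); rewrite ev'.
apply/asboolP; exists x, u, s, (w + w'); split => //.
by rewrite vfun_incl linearD -e -e' vv' [X in _ = vincl X]addrC addrA subrK.
Qed.

Definition coker_equiv := EquivRel coker_rel coker_refl coker_sym coker_trans.

Definition Coker : Type := quotient_topology {eq_quot coker_equiv}.

HB.instance Definition _ := Topological.on Coker.
HB.instance Definition _ := Quotient.on Coker.

End Cokernel.

Section Families.
Variables (K : numFieldType) (X : topologicalType).

Section Trivial.
Variable V : vectType K.

Let incl (x : X) (v : V) : X * fdtop V := (x, v).

Let incl_inj x : injective (incl x).
Proof. by move=> u v [->]. Qed.

Let proj_incl x (v : V) : (incl x v).1 = x.
Proof. by []. Qed.

Let incl_surj (y : X * fdtop V) : exists v : V, incl y.1 v = y.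
Proof. by exists y.2; case: y. Qed.

Let proj_continuous : continuous (fst : X * fdtop V -> X).
Proof. by move=> y; exact: cvg_fst. Qed.

Definition trivial_family : vfamily K X :=
  @VFamily K X (X * fdtop V)%type fst (fun=> V) incl
    proj_continuous incl_inj proj_incl incl_surj.

End Trivial.

Section Sub.
Variables (V : vectType K) (E : X -> {vspace V}).

Definition sub_total : Type := set_type [set y : X * fdtop V | (y.2 : V) \in E y.1].

HB.instance Definition _ := Topological.on sub_total.

Definition sub_incl x (v : subvs_of (E x)) : sub_total :=
  exist _ (x, vsval v : fdtop V)
    (mem_set (subvsP v : [set y : X * fdtop V | (y.2 : V) \in E y.1] (x, vsval v))).

Definition sub_proj (y : sub_total) : X := (set_val y).1.

Let incl_inj x : injective (@sub_incl x).
Proof. by move=> u v /(congr1 (fun y : sub_total => (set_val y).2 : V)) e; exact: val_inj. Qed.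

Let proj_incl x (v : subvs_of (E x)) : sub_proj (sub_incl v) = x.
Proof. by []. Qed.

Let incl_surj (y : sub_total) :
  exists v : subvs_of (E (sub_proj y)), sub_incl v = y.
Proof.
case: y => -[x v] h; exists (Subvs (set_mem h)).
by rewrite /sub_incl /=; congr exist; exact: Prop_irrelevance.
Qed.

Let proj_continuous : continuous sub_proj.
Proof.
move=> y; apply: (@continuous_comp _ (X * fdtop V)%type _ set_val fst).
  exact: initial_continuous.
exact: cvg_fst.
Qed.

(* The family of vector spaces (E x)_x, topologised inside X * V. *)
Definition sub_family : vfamily K X :=
  @VFamily K X sub_total sub_proj (fun x => subvs_of (E x)) sub_incl
    proj_continuous incl_inj proj_incl incl_surj.

End Sub.
End Families.

Section FramedAffineBundles.
Variable K : numClosedFieldType.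

Notation poly2 := (mpoly.mpoly 2 K).

(* K[X_0, X_1]_k *)
Definition hpoly (k : nat) : Type := mpoly.dhomog 2 K k.

HB.instance Definition _ k := SubChoice.on (hpoly k).
HB.instance Definition _ k := Vector.on (hpoly k).

Definition hpoly_val k (p : hpoly k) : poly2 := mpoly.mpoly_of_dhomog p.

Section Multiplication.
Variables (d l1 l2 : nat) (dl : (d + l1 = l2)%N).

Lemma hpolyM_proof (Q : hpoly d) (p : hpoly l1) :
  hpoly_val Q * hpoly_val p \is mpoly.ishomog1 l2 mpoly.mdeg.
Proof. by rewrite -dl; apply: mpoly.dhomogM; exact: mpoly.dhomog_is_dhomog. Qed.

Definition hpolyM (Q : hpoly d) (p : hpoly l1) : hpoly l2 :=
  mpoly.DHomog (hpolyM_proof Q p).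

Lemma hpolyM_linear Q : linear (hpolyM Q).
Proof.
by move=> a p q; apply: val_inj; rewrite /= /hpoly_val/= mulrDr -scalerAr.
Qed.

HB.instance Definition _ Q :=
  GRing.isLinear.Build K (hpoly l1) (hpoly l2) _ (hpolyM Q) (hpolyM_linear Q).

Definition mulQ (Q : hpoly d) : 'Hom(hpoly l1, hpoly l2) := linfun (hpolyM Q).

Definition tmulQ (Q : hpoly d) : dual (hpoly l2) -> dual (hpoly l1) :=
  transpose (mulQ Q).

Lemma tmulQE Q (Phi : dual (hpoly l2)) (p : hpoly l1) :
  (tmulQ Q Phi : 'Hom(_, _)) p = (Phi : 'Hom(_, _)) (hpolyM Q p).
Proof. by rewrite /tmulQ /transpose comp_lfunE lfunE. Qed.

Lemma tmulQ_linear Q : linear (tmulQ Q).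
Proof.
move=> a Phi Psi; apply/lfunP => p.
by rewrite !(add_lfunE, scale_lfunE) !tmulQE add_lfunE scale_lfunE.
Qed.

Lemma tmulQ_linearl Phi : linear (tmulQ^~ Phi).
Proof.
move=> a Q Q'; apply/lfunP => p.
rewrite !(add_lfunE, scale_lfunE) !tmulQE -linearZ -linearD; congr (_ _).
by apply: val_inj; rewrite /= /hpoly_val/= mulrDl -scalerAl.
Qed.

End Multiplication.

Section G0.
Variable d : nat.

(* (Q, u) stands for the matrix G0_mx (Q, u) below. *)
Definition G0 : Type := (hpoly d * {u : K | u != 0})%type.

HB.instance Definition _ := Choice.on G0.

Definition G0_Q (g : G0) : hpoly d := g.1.
Definition G0_u (g : G0) : K := val g.2.

Definition G0_mx (g : G0) : 'M[poly2]_2 :=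
  \matrix_(i, j) if i == 0 then (if j == 0 then 1 else hpoly_val (G0_Q g))
                 else (if j == 0 then 0 else mpoly.mpolyC 2 (G0_u g)).

Definition G0_make (Q : hpoly d) (u : K) (u0 : u != 0) : G0 := (Q, exist _ u u0).

Definition G0_one : G0 := G0_make 0 (oner_neq0 K).
Definition G0_mul (g h : G0) : G0 :=
  G0_make (G0_Q h + G0_u h *: G0_Q g) (mulf_neq0 (valP g.2) (valP h.2)).
Definition G0_inv (g : G0) : G0 :=
  G0_make (- ((G0_u g)^-1 *: G0_Q g)) (invr_neq0 (valP g.2)).

Lemma G0_eqP (g h : G0) : G0_Q g = G0_Q h -> G0_u g = G0_u h -> g = h.
Proof. by case: g h => [Q u] [Q' u'] /= eQ eu; congr pair => //; exact: val_inj. Qed.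

Lemma G0_mulA : associative G0_mul.
Proof.
move=> f g h; apply: G0_eqP; rewrite /G0_Q /G0_u /=; last exact: mulrA.
by rewrite scalerDr scalerA addrA mulrC.
Qed.

Lemma G0_mul1 : left_id G0_one G0_mul.
Proof.
move=> g; apply: G0_eqP; rewrite /G0_Q /G0_u /=; last exact: mul1r.
by rewrite scaler0 addr0.
Qed.

Lemma G0_1mul : right_id G0_one G0_mul.
Proof.
move=> g; apply: G0_eqP; rewrite /G0_Q /G0_u /=; last exact: mulr1.
by rewrite scale1r add0r.
Qed.

Lemma G0_mulV : left_inverse G0_one G0_inv G0_mul.
Proof.
move=> g; have u0 : G0_u g != 0 := valP g.2.
apply: G0_eqP; rewrite /G0_Q /G0_u /=; last exact: mulVf.
by rewrite scalerN scalerA mulfV // scale1r subrr.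
Qed.

Lemma G0_Vmul : right_inverse G0_one G0_inv G0_mul.
Proof.
move=> g; have u0 : G0_u g != 0 := valP g.2.
apply: G0_eqP; rewrite /G0_Q /G0_u /=; last exact: mulfV.
by rewrite addNr.
Qed.

HB.instance Definition _ :=
  isGroup.Build G0 G0_mulA G0_mul1 G0_1mul G0_mulV G0_Vmul.

Lemma G0_mx1 : G0_mx 1%g = 1%:M.
Proof.
apply/matrixP => i j; rewrite !mxE -val_eqE.
by case: i => -[|[|]] //= ?; case: j => -[|[|]].
Qed.

Lemma G0_mxM (g h : G0) : G0_mx (g * h)%g = G0_mx g *m G0_mx h.
Proof.
apply/matrixP => i j; rewrite !mxE big_ord_recl big_ord1 !mxE.
rewrite /hpoly_val /G0_Q /G0_u /=.
case: i => -[|[|//]] ? /=; case: j => -[|[|//]] ? /=;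
  rewrite ?(mul0r, mulr0, mulr1, mul1r, addr0, add0r) //.
- by rewrite mulrC mpoly.mul_mpolyC.
- by rewrite rmorphM.
Qed.

End G0.

Section Moduli.
Variables (d l1 l2 : nat) (dl : (d + l1 = l2)%N).

Notation W1 := (dual (hpoly l1)).
Notation W2 := (dual (hpoly l2)).

Definition G0_act (g : G0 d) (Phi : W1 * W2) : W1 * W2 :=
  (Phi.1 + tmulQ dl (G0_Q g) Phi.2, G0_u g *: Phi.2).

Lemma G0_act1 Phi : G0_act 1%g Phi = Phi.
Proof.
case: Phi => Phi Psi; congr pair; last exact: scale1r.
apply/lfunP => p; rewrite add_lfunE tmulQE /=.
rewrite (_ : hpolyM _ _ _ = 0) ?linear0 ?addr0 //.
by apply: val_inj; rewrite /= /hpoly_val /= mul0r.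
Qed.

Lemma G0_actM g h Phi : G0_act (g * h)%g Phi = G0_act g (G0_act h Phi).
Proof.
case: Phi => Phi Psi; congr pair; last by rewrite /= scalerA.
rewrite /= /G0_Q /G0_u /= -addrA; congr (_ + _).
pose l Q := HB.pack (tmulQ dl Q) (GRing.isLinear.Build K W2 W1 _ _ (@tmulQ_linear d l1 l2 dl Q)) : {linear W2 -> W1}.
have e : tmulQ dl (h.1 + val h.2 *: g.1) Psi =
    tmulQ dl h.1 Psi + val h.2 *: tmulQ dl g.1 Psi.
  by rewrite addrC [RHS]addrC; exact: tmulQ_linearl.
have e' : l g.1 (val h.2 *: Psi) = val h.2 *: l g.1 Psi by exact: linearZ.
by rewrite -[tmulQ dl g.1 _]/(l g.1 _) e'; exact: e.
Qed.

(* K[X_0, X_1]_{l1}^* (+) (K[X_0, X_1]_{l2}^* \ {0}) *)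
Definition Q0_pre : Type := (W1 * nonzero 'Hom(hpoly l2, K^o))%type.

HB.instance Definition _ := Topological.on Q0_pre.

Definition Q0_pre_val (Phi : Q0_pre) : W1 * W2 := (Phi.1, nzval Phi.2).

Definition orbit_rel (Phi Psi : Q0_pre) : bool :=
  `[< exists g : G0 d, G0_act g (Q0_pre_val Phi) = Q0_pre_val Psi >].

Lemma orbit_refl : reflexive orbit_rel.
Proof. by move=> Phi; apply/asboolP; exists 1%g; rewrite G0_act1. Qed.

Lemma orbit_sym : symmetric orbit_rel.
Proof.
suff h y z : orbit_rel y z -> orbit_rel z y by move=> y z; apply/idP/idP; exact: h.
move=> /asboolP[g e]; apply/asboolP; exists g^-1%g.
by rewrite -e -G0_actM mulVg G0_act1.
Qed.

Lemma orbit_trans : transitive orbit_rel.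
Proof.
move=> y x z /asboolP[g e] /asboolP[h f]; apply/asboolP.
by exists (h * g)%g; rewrite G0_actM e.
Qed.

Definition orbit_equiv := EquivRel orbit_rel orbit_refl orbit_sym orbit_trans.

Definition frakQ0 : Type := quotient_topology {eq_quot orbit_equiv}.

HB.instance Definition _ := Topological.on frakQ0.
HB.instance Definition _ := Quotient.on frakQ0.

Notation P := (projspace 'Hom(hpoly l2, K^o)).

(* Theta_P (x) K[X_0, X_1]_d *)
Definition taut_tens : vfamily K P :=
  sub_family (fun x : P => tens_vs (taut x) {:hpoly d}).

(* The linear map Phi (x) Q |-> tm_Q (Phi). *)
Definition tmul_tens : tensor 'Hom(hpoly l2, K^o) (hpoly d) -> W1 :=
  tens_lift (fun (Phi : W2) Q => tmulQ dl Q Phi).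

HB.instance Definition _ := GRing.Linear.on tmul_tens.

Lemma tmul_tensE (Phi : W2) Q : tmul_tens (tens Phi Q) = tmulQ dl Q Phi.
Proof.
apply: (@tens_liftE _ _ _ _ (fun (Phi : W2) Q => tmulQ dl Q Phi)).
  by move=> Psi; exact: tmulQ_linearl.
by move=> Q'; exact: tmulQ_linear.
Qed.

Definition H_target : vfamily K P := trivial_family P 'Hom(hpoly l1, K^o).

Definition H_fun (y : taut_tens) : H_target :=
  ((set_val y).1, tmul_tens (set_val y).2).

Definition H_fib (x : P) (t : vfibre taut_tens x) : vfibre H_target x :=
  tmul_tens (vsval t).

Lemma H_fib_linear x : linear (@H_fib x).
Proof. by move=> a s t; rewrite /H_fib linearP. Qed.

HB.instance Definition _ x :=
  GRing.isLinear.Build K (vfibre taut_tens x) (vfibre H_target x) _ (@H_fib x)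
    (@H_fib_linear x).

Lemma H_continuous : continuous H_fun.
Proof.
have pairc (T Y Z : topologicalType) (f : T -> Y) (g : T -> Z) :
    continuous f -> continuous g -> continuous (fun x => (f x, g x)).
  by move=> cf cg x; apply: cvg_pair; [exact: cf | exact: cg].
apply: (pairc taut_tens P (fdtop 'Hom(hpoly l1, K^o))) => y.
  exact: vproj_continuous.
apply: (@continuous_comp taut_tens (fdtop (tensor _ _)) (fdtop _)
  (fun y => (set_val y).2) tmul_tens); last exact: fdtop_linear_continuous.
apply: (@continuous_comp _ (P * fdtop (tensor _ _))%type _ set_val snd).
  exact: initial_continuous.
exact: cvg_snd.
Qed.

Lemma H_incl x (t : vfibre taut_tens x) : H_fun (vincl t) = vincl (H_fib t).
Proof. by []. Qed.

Definition Hmor : vmorphism taut_tens H_target :=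
  @VMorphism K P taut_tens H_target H_fun (fun x => @H_fib x)
     H_continuous H_incl.

Lemma tens_mem_taut (Phi : nonzero 'Hom(hpoly l2, K^o)) (Q : hpoly d) :
  tens (nzval Phi : 'Hom(_, _)) Q \in tens_vs (taut (pline Phi)) {:hpoly d}.
Proof.
by rewrite mem_tens_vs ?memvf // taut_pline memv_line.
Qed.

Lemma mem_taut_tens (Phi : nonzero 'Hom(hpoly l2, K^o)) t :
  t \in tens_vs (taut (pline Phi)) {:hpoly d} ->
  exists Q, t = tens (nzval Phi : 'Hom(_, _)) Q.
Proof.
rewrite taut_pline.
set phi := (nzval Phi : 'Hom(_, _)).
suff sub : (tens_vs <[phi]> {:hpoly d} <= limg (linfun (tens phi)))%VS.
  by move=> /(subvP sub) /memv_imgP[Q _ ->]; exists Q; rewrite lfunE.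
apply/span_subvP => _ /allpairsP[[a b] /= [/vbasis_mem /vlineP[c ->] _ ->]].
apply/memv_imgP; exists (c *: b); first exact: memvf.
by rewrite lfunE /= tensZl tensZr.
Qed.

(* H_[Phi] (Phi (x) Q) = ([Phi], tm_Q (Phi)) *)
Lemma HmorE (Phi : nonzero 'Hom(hpoly l2, K^o)) (Q : hpoly d) :
  Hmor (@vincl _ _ taut_tens (pline Phi) (Subvs (tens_mem_taut Phi Q))) =
  (pline Phi, tmulQ dl Q (nzval Phi)).
Proof. by congr pair; rewrite -tmul_tensE. Qed.

End Moduli.
End FramedAffineBundles.

Lemma degE (n1 n2 : int) (l1 l2 d : nat) :
  l1%:Z = -2 - n1 -> l2%:Z = -2 - n2 -> d%:Z = n1 - n2 -> (d + l1 = l2)%N.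
Proof.
move=> e1 e2 ed; apply/eqP; rewrite -eqz_nat PoszD e1 e2 ed.
by rewrite addrC addrA subrK.
Qed.

(* Main.v *)
(** The map (Phi1, Phi2) |-> ([Phi2], Phi1) is continuous and surjective, and it
    is open because the projection of the nonzero vectors onto the projective
    space is: the saturation of an open set is a union of translates by the
    homeomorphisms w |-> c w.  Its composite with the projection to Coker(H) is
    therefore a topological quotient map, and two points have the same image
    exactly when they lie in the same G_0-orbit. *)
Require Import Defs.
From mathcomp Require Import all_boot all_order all_algebra.
From mathcomp Require Import generic_quotient.
From mathcomp Require Import all_classical all_reals topology normedtype.
From mathcomp Require Import complex.

Set Implicit Arguments.
Unset Strict Implicit.
Unset Printing Implicit Defensive.

Import Order.TTheory GRing.Theory Num.Theory.
Import numFieldNormedType.Exports.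

Local Open Scope ring_scope.
Local Open Scope complex_scope.
Local Open Scope quotient_scope.

Lemma pair_continuous (T Y Z : topologicalType) (f : T -> Y) (g : T -> Z) :
  continuous f -> continuous g -> continuous (fun x => (f x, g x)).
Proof. by move=> cf cg x; apply: cvg_pair; [exact: cf|exact: cg]. Qed.

Section ProjectiveSpace.
Local Open Scope classical_set_scope.
Variables (K : numFieldType) (W : vectType K).

Lemma pline_continuous : continuous (@pline K W).
Proof. exact: pi_continuous. Qed.

Lemma pline_repr (x : projspace W) : pline (repr x) = x.
Proof. exact: reprK. Qed.

Lemma nonzero_scale_proof (c : K) (w : nonzero W) :
  c != 0 -> [set w : fdtop W | w != 0] (c *: nzval w).
Proof. by move=> c0; rewrite /= scaler_eq0 negb_or c0 nzvalP. Qed.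

Definition nonzero_scale (c : K) (c0 : c != 0) (w : nonzero W) : nonzero W :=
  exist _ (c *: nzval w) (mem_set (nonzero_scale_proof w c0)).

Lemma nonzero_scale_continuous (c : K) (c0 : c != 0) :
  continuous (nonzero_scale c0).
Proof.
apply: continuous_comp_initial => w.
apply: (@continuous_comp (nonzero W) (fdtop W) (fdtop W) set_val
  (GRing.scale c)); first exact: initial_continuous.
exact: (@fdtop_linear_continuous K W W (GRing.scale c)).
Qed.

Lemma open_pline (A : set (nonzero W)) : open A -> open (@pline K W @` A).
Proof.
move=> oA.
(* The two propositions are convertible: openness in the quotient topology is openness of the
   preimage. *)
have -> : open (@pline K W @` A) = open (@pline K W @^-1` (@pline K W @` A)).
  by [].
have -> : @pline K W @^-1` (@pline K W @` A) =
    \bigcup_(c in [set: {c : K | c != 0}]) (nonzero_scale (valP c) @^-1` A).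
  apply/seteqP; split => [v [w Aw /esym/plineP/asboolP[c [c0 e]]]|v [c _ Acv]].
    exists (exist _ c c0) => //=; rewrite (_ : nonzero_scale _ v = w) //.
    exact/val_inj/esym.
  exists (nonzero_scale (valP c) v) => //; apply/esym/plineP/asboolP.
  by exists (val c); split; [exact: (valP c)|].
apply: bigcup_open => c _.
by have /continuousP/(_ A oA) := @nonzero_scale_continuous _ (valP c).
Qed.

(** Openness of the projection in pointwise form, ready for the neighbourhood argument in
    [Coker_Q0_continuous]. *)
Lemma nbhs_pline (w : nonzero W) (A : set (nonzero W)) :
  nbhs w A -> nbhs (pline w) (@pline K W @` A).
Proof.
rewrite nbhsE => -[B [oB Bw] BA].
apply: (@filterS _ _ _ (@pline K W @` B)); first exact: image_subset.
apply: open_nbhs_nbhs.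
by split; [exact: open_pline|exists w].
Qed.

End ProjectiveSpace.

Section Comparison.
Variables (K : numClosedFieldType) (d l1 l2 : nat) (dl : (d + l1 = l2)%N).

Notation W1 := (dual (hpoly K l1)).
Notation P := (projspace 'Hom(hpoly K l2, K^o)).

(** The two entries of a matrix in G_0 play separate roles: [u] makes [Phi.2] and [Psi.2] span the
    same line, while the tensor of [Phi.2] with [Q] is sent by H to the difference
    [Psi.1 - Phi.1]. *)
Lemma orbit_relE (Phi Psi : Q0_pre K l1 l2) :
  orbit_rel dl Phi Psi =
  coker_rel (Hmor K dl) (pline Phi.2, Phi.1) (pline Psi.2, Psi.1).
Proof.
case: Phi Psi => [Phi1 Phi2] [Psi1 Psi2] /=.
apply/asboolP/asboolP => [[g [e1 e2]]|[x [u [v [w [eu ev e]]]]]].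
  have e : pline Phi2 = pline Psi2.
    by apply/plineP/asboolP; exists (G0_u g); rewrite e2; split=> //; exact: valP g.2.
  exists (pline Phi2), Phi1, Psi1, (Subvs (tens_mem_taut Phi2 (G0_Q g))).
  split => //; first by rewrite -e.
  by rewrite HmorE -e1 /= addrC addKr.
case: eu => ex eu; case: ev => ex' ev; case: e => e; subst x u v.
(* The tautological fibre is the line spanned by [Phi2], so [w] is a pure tensor of [Phi2] with some
   [Q]. *)
have [Q eQ] := mem_taut_tens (subvsP w).
move: e; rewrite [vsval w]eQ tmul_tensE => e.
(* The ratio of the two vectors on the common line becomes the lower right entry of the matrix. *)
have /plineP/asboolP[c [c0 ec]] := ex'.
exists (G0_make Q c0); rewrite /G0_act /Q0_pre_val /= ec; congr pair.
by rewrite -[tmulQ _ _ _]e addrC subrK.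
Qed.

Definition Q0_Coker (x : frakQ0 K dl) : Coker (Hmor K dl) :=
  \pi_(Coker (Hmor K dl)) (pline (repr x).2, (repr x).1).

(** Two choices enter: a representative of the class, and a nonzero vector on its line. Neither
    affects the result, by [Coker_Q0E]. *)
Definition Coker_Q0 (y : Coker (Hmor K dl)) : frakQ0 K dl :=
  \pi_(frakQ0 K dl) ((repr y).2, repr (repr y).1).

(** The chosen representative lies in the orbit of [(Phi1, Phi2)], and [orbit_relE] turns this into
    equality of cokernel classes. *)
Lemma Q0_CokerE Phi1 Phi2 :
  Q0_Coker (\pi_(frakQ0 K dl) (Phi1, Phi2)) =
  \pi_(Coker (Hmor K dl)) (pline Phi2, Phi1).
Proof.
apply/eqmodP; rewrite /= -(orbit_relE (repr _) (Phi1, Phi2)).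
by have /eqmodP := reprK (\pi_(frakQ0 K dl) (Phi1, Phi2)).
Qed.

Lemma Coker_Q0E Phi1 Phi2 :
  Coker_Q0 (\pi_(Coker (Hmor K dl)) (pline Phi2, Phi1)) =
  \pi_(frakQ0 K dl) (Phi1, Phi2).
Proof.
apply/eqmodP; rewrite /= orbit_relE /= pline_repr -surjective_pairing.
by have /eqmodP := reprK (\pi_(Coker (Hmor K dl)) (pline Phi2, Phi1)).
Qed.

Lemma Q0_CokerK : cancel Q0_Coker Coker_Q0.
Proof. by move=> x; rewrite Coker_Q0E -surjective_pairing reprK. Qed.

Lemma Coker_Q0K : cancel Coker_Q0 Q0_Coker.
Proof.
by move=> y; rewrite Q0_CokerE pline_repr -surjective_pairing reprK.
Qed.

Lemma Q0_Coker_continuous : continuous Q0_Coker.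
Proof.
apply/quotient_continuous.
rewrite (_ : _ \o _ = \pi_(Coker (Hmor K dl)) \o
  (fun Phi : Q0_pre K l1 l2 => (pline Phi.2, Phi.1) : H_target K l1 l2)); last first.
  by apply/funext => -[Phi1 Phi2]; exact: Q0_CokerE.
move=> Phi; apply: continuous_comp; last exact: pi_continuous.
apply: (pair_continuous (T := Q0_pre K l1 l2) (Y := P) (Z := W1)) => {}Phi.
  apply: (@continuous_comp (Q0_pre K l1 l2) (nonzero _) P snd).
    exact: cvg_snd.
  exact: pline_continuous.
exact: cvg_fst.
Qed.

Lemma Coker_Q0_continuous : continuous Coker_Q0.
Proof.
apply/quotient_continuous => -[x Phi1].
(* Lifting [x] to a nonzero vector moves the neighbourhood question up to [Q0_pre]. *)
rewrite -(pline_repr x) => N /=; rewrite Coker_Q0E => nN.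
have [[A B] /= [nA nB] AB] : nbhs ((Phi1, repr x) : Q0_pre K l1 l2)
  (\pi_(frakQ0 K dl) @^-1` N)%classic.
  exact: (@pi_continuous (Q0_pre K l1 l2) _ (Phi1, repr x) N nN).
(* The box around the lift projects to a box around the given point, with the factors swapped. *)
exists (@pline _ _ @` B, A)%classic => /=; first by split; [exact: nbhs_pline|].
move=> [_ Psi1] /= [[Psi2 BPsi2 <-] APsi1].
by rewrite /= Coker_Q0E; exact: (AB (Psi1, Psi2)).
Qed.

End Comparison.

Theorem proposition3p3 (R : realType) (n1 n2 : int) (l1 l2 d : nat)
    (hn1 : n1 < -2) (hn2 : n2 < n1)
    (hl1 : l1%:Z = -2 - n1) (hl2 : l2%:Z = -2 - n2) (hd : d%:Z = n1 - n2) :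
  let dl : (d + l1 = l2)%N := degE hl1 hl2 hd in
  exists f : frakQ0 R[i] dl -> Coker (Hmor R[i] dl),
    homeomorphism f /\
    forall (Phi1 : dual (hpoly R[i] l1))
           (Phi2 : nonzero 'Hom(hpoly R[i] l2, R[i]^o)),
      f (\pi_(frakQ0 R[i] dl) (Phi1, Phi2)) =
      \pi_(Coker (Hmor R[i] dl)) (pline Phi2, Phi1).
Proof.
move=> dl; exists (@Q0_Coker _ _ _ _ dl); split; last exact: Q0_CokerE.
split; first exact: Q0_Coker_continuous.
exists (@Coker_Q0 _ _ _ _ dl); split.
- exact: Coker_Q0_continuous.
- exact: Q0_CokerK.
- exact: Coker_Q0K.
Qed.
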